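(* Let $\alpha$ be a composition (a finite sequence of positive integers) with at most three parts. (1) If $\alpha=(a)$ has one part, then $L(\alpha)$ admits a symmetric chain decomposition. (2) If $\alpha=(a,b)$ has two parts, then $L(\alpha)$ admits a bottom centered chain decomposition. (3) If $\alpha=(a,b,c)$ has three parts, then $L(\alpha)$ admits a chain decomposition which is bottom centered if $a>c$, top centered if $a<c$, and symmetric if $a=c$.
   Context: For a composition $\alpha=(\alpha_1,\ldots,\alpha_s)$ of $n-1$ (positive integers with sum $n-1$), the fence poset $F(\alpha)$ has elements $x_1,\ldots,x_n$. For $1\le i\le s$ its $i$th segment is the set $\{x_j : \alpha_1+\cdots+\alpha_{i-1}+1\le j\le \alpha_1+\cdots+\alpha_i+1\}$. The covering relations are: consecutive elements of the $i$th segment satisfy $x_j\lhd x_{j+1}$ if $i$ is odd and $x_j\rhd x_{j+1}$ if $i$ is even. $L(\alpha)$ is the distributive lattice of all lower order ideals of $F(\alpha)$ ordered by inclusion; it is ranked by cardinality of ideals, so its rank is $n=\#F(\alpha)$. Let $P$ be a ranked poset of rank $n$. A chain decomposition (CD) of $P$ is a set partition of $P$ into saturated chains. If $C$ is a saturated chain with minimum $x$ and maximum $y$, its center is $\operatorname{cen} C=(\operatorname{rk}x+\operatorname{rk}y)/2$. A CD is symmetric if every chain $C$ in it has $\operatorname{cen}C=n/2$; top centered if every chain $C$ in it has $\operatorname{cen}C\in\{n/2,(n+1)/2\}$; bottom centered if every chain $C$ in it has $\operatorname{cen}C\in\{n/2,(n-1)/2\}$. *)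

(* Defs.v *)
From HB Require Import structures.
From mathcomp Require Import all_boot all_order all_algebra.
Set Implicit Arguments.
Unset Strict Implicit.
Unset Printing Implicit Defensive.
Import Order.TTheory GRing.Theory Num.Theory.

Section Chains.
Context {disp : Order.disp_t} {T : finPOrderType disp}.
Local Open Scope order_scope.

(* [covers x y] : y covers x. *)
Definition covers : rel T :=
  fun x y => (x < y) && ~~ [exists z : T, (x < z) && (z < y)].

Definition saturated_chain (C : {set T}) : Prop :=
  exists x s, path covers x s /\ C = [set z in x :: s].

Definition chain_decomposition (D : {set {set T}}) : Prop :=
  partition D [set: T] /\ (forall C, C \in D -> saturated_chain C).

Definition is_minimum (C : {set T}) (x : T) : Prop :=
  x \in C /\ (forall z, z \in C -> x <= z).

Definition is_maximum (C : {set T}) (y : T) : Prop :=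
  y \in C /\ (forall z, z \in C -> z <= y).

(* [rk] makes T a ranked poset of rank n. *)
Definition ranked_by (rk : T -> nat) (n : nat) : Prop :=
  [/\ forall x, (forall z, ~~ (z < x)) -> rk x = 0%N,
      forall x y, covers x y -> rk y = (rk x).+1
    & forall x, (forall z, ~~ (x < z)) -> rk x = n].

Local Open Scope ring_scope.

Definition has_center (rk : T -> nat) (C : {set T}) (c : rat) : Prop :=
  exists x y, [/\ is_minimum C x, is_maximum C y
                & c = ((rk x)%:R + (rk y)%:R) / 2].

Definition symmetric_CD rk n (D : {set {set T}}) : Prop :=
  chain_decomposition D /\
  (forall C, C \in D -> has_center rk C (n%:R / 2)).

Definition top_centered_CD rk n (D : {set {set T}}) : Prop :=
  chain_decomposition D /\
  (forall C, C \in D ->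
     has_center rk C (n%:R / 2) \/ has_center rk C ((n%:R + 1) / 2)).

Definition bottom_centered_CD rk n (D : {set {set T}}) : Prop :=
  chain_decomposition D /\
  (forall C, C \in D ->
     has_center rk C (n%:R / 2) \/ has_center rk C ((n%:R - 1) / 2)).

End Chains.

Section LowerIdeals.
Context {disp : Order.disp_t} (T : finPOrderType disp).
Local Open Scope order_scope.

Definition lower_ideal : pred {set T} :=
  fun I => [forall x in I, forall y : T, (y <= x) ==> (y \in I)].

Lemma lower_idealP (I : {set T}) :
  reflect (forall x y, x \in I -> y <= x -> y \in I) (lower_ideal I).
Proof.
apply: (iffP forall_inP) => [h x y xI yx|h x xI].
  by have /forallP/(_ y)/implyP := h x xI; apply.
by apply/forallP => y; apply/implyP; exact: h.
Qed.

Record ideals := Ideal { ideal_set :> {set T}; _ : lower_ideal ideal_set }.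

HB.instance Definition _ := [isSub for ideal_set].
HB.instance Definition _ := [Finite of ideals by <:].

Definition ideal_le : rel ideals := fun I J => ideal_set I \subset ideal_set J.

Lemma ideal_le_refl : reflexive ideal_le.
Proof. by move=> I; exact: subxx. Qed.

Lemma ideal_le_anti : antisymmetric ideal_le.
Proof. by move=> I J IJ; apply/val_inj/eqP; rewrite eqEsubset; exact: IJ. Qed.

Lemma ideal_le_trans : transitive ideal_le.
Proof. by move=> J I K; exact: subset_trans. Qed.

Fact ideal_display : Order.disp_t. Proof. exact: (Order.Disp tt tt). Qed.

HB.instance Definition _ := Order.Le_isPOrder.Build ideal_display ideals
  ideal_le_refl ideal_le_anti ideal_le_trans.

Definition ideal_rank (I : ideals) : nat := #|ideal_set I|.

Lemma ideal_rank_covers (I J : ideals) :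
  covers I J -> ideal_rank J = (ideal_rank I).+1.
Proof.
rewrite /covers /ideal_rank => /andP[ltIJ /existsPn noK].
have sIJ : ideal_set I \subset ideal_set J by exact: (ltW ltIJ).
have [x0 x0J x0I] : exists2 x, x \in ideal_set J & x \notin ideal_set I.
  apply/subsetPn; apply: contraL ltIJ => sJI.
  by rewrite lt_leAnge negb_and negbK; apply/orP; right.
pose D := ideal_set J :\: ideal_set I.
have x0D : x0 \in D by rewrite inE x0I.
case: (@arg_minnP _ x0 (fun x => x \in D) (fun x => #|[set y in D | y < x]|) x0D).
move=> x xD xmin.
have [xI xJ] : x \notin ideal_set I /\ x \in ideal_set J.
  by move: xD; rewrite inE => /andP.
have below y : y < x -> y \in ideal_set I.
  move=> yx; apply: contraT => yI.
  have yD : y \in D.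
    by rewrite inE yI /=; exact: (lower_idealP _ (valP J) x y xJ (ltW yx)).
  have := xmin y yD; rewrite leqNgt => /negP; case; apply: proper_card.
  apply/properP; split.
    by apply/subsetP => z; rewrite !inE => /andP[-> zy] /=; exact: lt_trans yx.
  by exists y; rewrite inE ?ltxx ?andbF // yD.
have Kideal : lower_ideal (x |: ideal_set I).
  apply/lower_idealP => u v; rewrite !in_setU1 => /orP[/eqP->|uI] vu.
    by move: vu; rewrite le_eqVlt => /orP[->//|/below->]; rewrite orbT.
  by rewrite (lower_idealP _ (valP I) u v uI vu) orbT.
have ltIK : I < Ideal Kideal.
  rewrite lt_leAnge; apply/andP; split; first exact: subsetUr.
  by apply/subsetPn; exists x; rewrite //= setU11.
have leKJ : Ideal Kideal <= J.
  by apply/subsetP => u /=; rewrite in_setU1 => /orP[/eqP->//|]; exact/subsetP.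
have eqKJ : Ideal Kideal = J.
  have := noK (Ideal Kideal); rewrite ltIK /= => nlt; apply/eqP.
  by move: leKJ; rewrite le_eqVlt (negPf nlt) orbF.
by rewrite -eqKJ /= cardsU1 xI.
Qed.

Lemma lower_ideal0 : lower_ideal set0.
Proof. by apply/lower_idealP => x y; rewrite inE. Qed.

Lemma lower_idealT : lower_ideal [set: T].
Proof. by apply/lower_idealP => x y; rewrite !inE. Qed.

Lemma ideals_ranked : ranked_by ideal_rank #|T|.
Proof.
split; last 1 first.
- move=> I maxI; have : I <= Ideal lower_idealT by exact: subsetT.
  by rewrite le_eqVlt (negPf (maxI _)) orbF => /eqP->; exact: cardsT.
- move=> I minI; have : Ideal lower_ideal0 <= I by exact: sub0set.
  by rewrite le_eqVlt (negPf (minI _)) orbF => /eqP<-; exact: cards0.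
- exact: ideal_rank_covers.
Qed.

End LowerIdeals.

Section Fence.
Variable alpha : seq nat.

Definition is_composition : bool := all (leq 1) alpha.

(* Indices are shifted down by one: the element x_j of the fence is the ordinal
   j - 1, and the i-th segment is [segment (i - 1)]; in particular, odd
   segments correspond to even arguments of [segment]. *)
Definition fence := 'I_(sumn alpha).+1.

HB.instance Definition _ := Finite.on fence.

Definition segment (i : nat) : {set fence} :=
  [set x : fence | sumn (take i alpha) <= x <= sumn (take i.+1 alpha)].

(* [fence_cover x y] : y is declared to cover x. *)
Definition fence_cover : rel fence := fun x y =>
  [exists i : 'I_(size alpha), [&& x \in segment i, y \in segment i &
     if odd i then val x == (val y).+1 else val y == (val x).+1]].

Definition fence_le : rel fence := connect fence_cover.

Local Open Scope ring_scope.

Let step (t : nat) : int :=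
  (-1) ^+ (\sum_(i < size alpha) (sumn (take i.+1 alpha) <= t))%N.
Let height (x : nat) : int := \sum_(t < x) step t.

Let stepE (i : 'I_(size alpha)) t :
    (sumn (take i alpha) <= t < sumn (take i.+1 alpha))%N ->
  step t = (-1) ^+ i.
Proof.
have mono a b : (a <= b -> sumn (take a alpha) <= sumn (take b alpha))%N.
  move=> ab; have -> : take b alpha = take a alpha ++ drop a (take b alpha).
    by rewrite -[in LHS](cat_take_drop a (take b alpha)) take_takel.
  by rewrite sumn_cat leq_addr.
move=> /andP[lo hi]; rewrite /step; congr (_ ^+ _).
rewrite -big_mkcond /= sum1_card -[RHS]card_ord.
have le_is : (i <= size alpha)%N by exact: ltnW.
rewrite -(card_image (f := widen_ord le_is)); last first.
  by move=> u v /(congr1 val) /= /val_inj.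
apply: eq_card => j; rewrite unfold_in; apply/idP/imageP.
  move=> jt; have ji : (j < i)%N.
    rewrite ltnNge; apply: contraL jt => ij; rewrite -ltnNge.
    by apply: leq_trans hi _; apply: mono.
  by exists (Ordinal ji) => //; apply: val_inj.
move=> [k _ ->] /=; apply: leq_trans lo; exact: mono.
Qed.

Let height_cover x y : fence_cover x y -> height y = height x + 1.
Proof.
case/existsP=> i; rewrite !inE => /and3P[/andP[x1 x2] /andP[y1 y2]].
case: ifPn => oi /eqP e.
  rewrite e /height big_ord_recr /= (@stepE i) ?y1 -?e //.
  by rewrite -signr_odd oi expr1 addrNK.
rewrite e /height big_ord_recr /= (@stepE i) ?x1 -?e //.
by rewrite -signr_odd (negPf oi) expr0.
Qed.

Let height_le x y : fence_le x y -> x = y \/ height x < height y.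
Proof.
case/connectP=> p; elim: p x => [|z p IH] x /= => [_ ->|]; first by left.
case/andP=> xz pz ey; right; have hx := height_cover xz.
have lxz : height x < height z by rewrite hx ltrDl.
by case: (IH z pz ey) => [<-//|]; exact: lt_trans.
Qed.

Lemma fence_le_anti : antisymmetric fence_le.
Proof.
move=> x y /andP[xy yx]; have [//|lxy] := height_le xy.
have [//|lyx] := height_le yx.
by have := lt_trans lxy lyx; rewrite ltxx.
Qed.

Fact fence_display : Order.disp_t. Proof. exact: (Order.Disp tt tt). Qed.

HB.instance Definition _ := Order.Le_isPOrder.Build fence_display fence
  (connect0 fence_cover) fence_le_anti (@connect_trans _ fence_cover).

Lemma fence_coversE : covers =2 fence_cover.
Proof.
have ltE (x y : fence) : (x < y)%O -> height x < height y.
  rewrite lt_neqAle => /andP[nxy lxy]; case: (height_le lxy) => // exy.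
  by rewrite exy eqxx in nxy.
have covlt (x y : fence) : fence_cover x y -> (x < y)%O.
  move=> xy; rewrite lt_neqAle; apply/andP; split; last exact: connect1.
  by apply/eqP => e; have := height_cover xy; rewrite e => /eqP; rewrite addrC -subr_eq subrr.
move=> x y; apply/andP/idP => [[xy /existsPn nz]|xy].
  have /connectP[[|z p] /=] : fence_le x y := ltW xy.
    by move=> _ e; rewrite e ltxx in xy.
  case/andP=> xz pz ey; have zy : (z <= y)%O by apply/connectP; exists p.
  have := nz z; rewrite (covlt _ _ xz) /=; move: zy.
  by rewrite le_eqVlt => /orP[/eqP<-//|->].
split; first exact: covlt.
apply/existsPn => z; apply/negP => /andP[/ltE xz /ltE zy].
by move: zy; rewrite (height_cover xy) ltzD1 leNgt xz.
Qed.

End Fence.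

(* The lattice L(alpha), ranked by cardinality. *)
Notation fence_ideals alpha := (ideals (fence alpha)).
Notation fence_rank alpha := (@ideal_rank _ (fence alpha)).

(* Main.v *)
(** Put an ideal of F(a,b,c) in coordinates (i,m,k,p): the numbers of its
    elements on the first segment below the peak, on the second segment below
    the peak, on the third segment above the valley, and at the peak.  The
    ideals with m > 0 and p = 0 form the box [0,a] x [1,b] x [0,c], which is
    centered at n/2.  One long chain, of ranks 0 to n, consists of the ideals
    with m = 0, the line i = a, k = 0 of the box, and the ideals with p = 1.
    What remains of the box is ([0,a] x [0,c] minus (a,0)) x [1,b].  Decompose
    [0,a] x [0,c] into the symmetric hooks (t,0) -> (t,c-t) -> (a,c-t): the
    corner (a,0) is the top of the last hook if a > c, its bottom if a < c, and
    the whole hook if a = c, so deleting it lowers one center by 1/2, raises one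
    center by 1/2, or removes a hook.  Each product of a hook with [1,b] is
    again decomposed into hooks.  Compositions with fewer parts are the cases c = 0
    and b = c = 0. *)

Require Import Defs.
From mathcomp Require Import all_boot all_order all_algebra zify.

(** * Chain decompositions from labelings *)

(** Each fiber of [lab] is ordered by rank and meets each rank between its bounds once. As [rk] is
    strictly increasing, nothing fits between consecutive ranks, so the fiber is a saturated
    chain. *)
Lemma chain_decomposition_of_labels (disp : Order.disp_t)
    (T : finPOrderType disp) (L : eqType) (rk : T -> nat) (lab : T -> L)
    (lo hi : L -> nat) :
    (forall x y : T, (x < y)%O -> rk x < rk y) ->
    (forall x, lo (lab x) <= rk x <= hi (lab x)) ->
    (forall x r, lo (lab x) <= r <= hi (lab x) ->
       exists2 y, lab y = lab x & rk y = r) ->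
    (forall x y : T, lab x = lab y -> rk x <= rk y -> (x <= y)%O) ->
  let D := preim_partition lab [set: T] in
  chain_decomposition D /\
  forall C, C \in D -> exists x u v,
    [/\ is_minimum C u, is_maximum C v, rk u = lo (lab x) & rk v = hi (lab x)].
Proof.
move=> rk_lt rk_lab ex_lab le_lab D.
have DP C : C \in D -> exists x, forall y, (y \in C) = (lab y == lab x).
  by case/imsetP=> x _ ->; exists x => y; rewrite !inE /= eq_sym.
split=> [|C /DP[x Cx]]; last first.
  have /andP[lox hix] := rk_lab x.
  have [u lu ru] : exists2 u, lab u = lab x & rk u = lo (lab x).
    by apply: ex_lab; rewrite leqnn (leq_trans lox).
  have [v lv rv] : exists2 v, lab v = lab x & rk v = hi (lab x).
    by apply: ex_lab; rewrite leqnn (leq_trans lox).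
  exists x, u, v; split=> //; split=> [|z]; rewrite Cx ?lu ?lv //.
    by move=> /eqP lz; apply: le_lab; rewrite ?lz // ru -lz; case/andP: (rk_lab z).
  by move=> /eqP lz; apply: le_lab; rewrite ?lz // rv -lz; case/andP: (rk_lab z).
split; first exact: preim_partitionP.
move=> C /DP[x Cx].
have le_lohi : lo (lab x) <= hi (lab x).
  by have /andP[lox hix] := rk_lab x; exact: leq_trans hix.
pose g r := odflt x [pick y | (lab y == lab x) && (rk y == r)].
have gP r : lo (lab x) <= r <= hi (lab x) -> lab (g r) = lab x /\ rk (g r) = r.
  move=> /ex_lab[y ly ry]; rewrite /g; case: pickP => [z /andP[/eqP ? /eqP ?] //|].
  by move/(_ y); rewrite ly ry !eqxx.
exists (g (lo (lab x))), [seq g r | r <- iota (lo (lab x)).+1 (hi (lab x) - lo (lab x))].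
split.
  have path_g m l : lo (lab x) <= l -> l + m <= hi (lab x) ->
      path covers (g l) [seq g r | r <- iota l.+1 m].
    elim: m l => [//|m IHm] l lol hil /=; rewrite IHm ?andbT; try by lia.
    have [l1 r1] := gP l ltac:(lia); have [l2 r2] := gP l.+1 ltac:(lia).
    have lt_g : (g l < g l.+1)%O.
      rewrite Order.POrderTheory.lt_neqAle le_lab ?r1 ?r2 ?l1 ?l2 // andbT.
      by apply/eqP => e; move: r2; rewrite -e r1; lia.
    rewrite /covers lt_g; apply/existsPn => z; apply/negP => /andP[/rk_lt lz /rk_lt zl].
    by move: lz zl; rewrite r1 r2; lia.
  by apply: path_g; lia.
apply/setP => y; rewrite Cx inE -map_cons -[_ :: iota _ _]/(iota (lo (lab x)) _.+1).
apply/eqP/mapP => [ly|[r]].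
  have := rk_lab y; rewrite ly => rky; exists (rk y); first by rewrite mem_iota; lia.
  have [lg rg] := gP _ rky.
  by apply: Order.POrderTheory.le_anti; rewrite !le_lab ?lg ?rg ?ly.
by rewrite mem_iota => rr ->; have [] := gP r ltac:(lia).
Qed.

(** * Hooks, thresholds and interval counts *)

(** [minn i (c - k)] is the index [t] of the hook through [(i, k)]: a point of it has [i = t] or
    [k = c - t], so its position is determined by [i + k]. *)
Lemma hook_mono c i k i' k' : k <= c -> k' <= c ->
  minn i (c - k) = minn i' (c - k') -> i + k <= i' + k' -> (i <= i') && (k <= k').
Proof. lia. Qed.

Lemma hook_exists a c t s : t <= a -> t <= c -> t <= s <= a + c - t ->
  exists i k, [/\ i <= a, k <= c, minn i (c - k) = t & i + k = s].
Proof.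
(* The hook turns at [(t, c - t)], whose sum is [c]. *)
move=> ta tc ts; have [sc|cs] := leqP s c.
  by exists t, (s - t); split; lia.
by exists (s - (c - t)), (c - t); split; lia.
Qed.

Lemma threshold (P : pred nat) N : (forall x, x.+1 < N -> P x.+1 -> P x) ->
  exists2 i, i <= N & forall x, x < N -> P x = (x < i).
Proof.
elim: N => [|N IHN] dP; first by exists 0.
have [|i iN Pi] := IHN; first by move=> x xN; apply: dP; lia.
case PN: (P N); last first.
  by exists i => [|x xN]; [lia | have [->|?] := eqVneq x N; [lia | apply: Pi; lia]].
exists N.+1 => // x xN; rewrite xN; have [->//|x_neN] := eqVneq x N.
suff iN' : i = N by rewrite Pi ?iN'; lia.
case: N {IHN} => [|N] in iN dP Pi PN xN x_neN *; first by lia.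
by have := dP N ltac:(lia) PN; rewrite Pi; lia.
Qed.

Lemma sum_interval n l h : h <= n -> (\sum_(x < n) (l <= x < h) = h - l)%N.
Proof.
(* With [minn n h] the equation holds for every [n], as the induction requires. *)
move=> hn; rewrite -[h in RHS](minn_idPr hn) => {hn}.
by elim: n => [|n IHn]; rewrite ?big_ord0 ?big_ord_recr /= ?IHn; lia.
Qed.

(** * Coordinates of ideals and labels of chains *)

Definition coords : Type := nat * nat * nat * nat.

Section Coordinates.
Variables a b c : nat.

(** The implications express closure downwards: the third segment lies above the valley, which [m]
    counts first, and the peak lies above both its slopes. *)
Definition valid_coords (q : coords) : bool := let: (i, m, k, p) := q in
  [&& i <= a, m <= b, k <= c, p <= 1, (0 < k) ==> (0 < m)
    & (0 < p) ==> (i == a) && (m == b)].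

Definition coord_sum (q : coords) : nat := let: (i, m, k, p) := q in i + m + k + p.

(** The peak has index [a] and the valley index [a + b]; the second segment is filled from the
    valley, hence from the right. *)
Definition coord_mem (q : coords) (x : nat) : bool := let: (i, m, k, p) := q in
  [|| 0 <= x < i, a <= x < a + p, (a + b).+1 - m <= x < (a + b).+1
    | (a + b).+1 <= x < (a + b).+1 + k].

Definition coord_le (q q' : coords) : bool :=
  let: (i, m, k, p) := q in let: (i', m', k', p') := q' in
  [&& i <= i', m <= m', k <= k' & p <= p'].

Lemma coord_mem_inj q q' : valid_coords q -> valid_coords q' ->
  (forall x, x <= a + b + c -> coord_mem q x = coord_mem q' x) -> q = q'.
Proof.
case: q q' => [[[i m] k] p] [[[i' m'] k'] p'] /= V V' E.
(* At these indices membership differs as soon as the corresponding coordinates differ. *)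
have Ei := E (minn i i'); have Em := E (a + b - minn m m').
have Ek := E ((a + b).+1 + minn k k'); have Ep := E a.
have -> : i = i' by clear Em Ek Ep; lia.
have -> : m = m' by clear Ei Ek Ep; lia.
have -> : k = k' by clear Ei Em Ep; lia.
by have -> : p = p' by clear Ei Em Ek; lia.
Qed.

Lemma coord_le_mem q q' x : valid_coords q' -> coord_le q q' ->
  coord_mem q x -> coord_mem q' x.
Proof. by case: q q' => [[[i m] k] p] [[[i' m'] k'] p'] /=; lia. Qed.

Lemma sum_coord_mem q : valid_coords q ->
  (\sum_(x < (a + b + c).+1) coord_mem q x)%N = coord_sum q.
Proof.
case: q => [[[i m] k] p] V.
transitivity (\sum_(x < (a + b + c).+1) ((0 <= x < i) + (a <= x < a + p) +
   ((a + b).+1 - m <= x < (a + b).+1) + ((a + b).+1 <= x < (a + b).+1 + k)))%N.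
  by apply: eq_bigr => x _; move: V => /=; lia.
by rewrite !big_split !sum_interval; move: V => /=; lia.
Qed.

(* The hook of index t in [0,a] x [0,c], without its end (a,0) for the last t,
   consists of the points with i + k from [hook_lo t] to [hook_hi t]. *)
Definition hook_lo t : nat := t + ((t == a) && (a <= c)).
Definition hook_hi t : nat := a + c - t - ((t == c) && (c < a)).

(* The long chain has label (0,0); the others have labels (t+1,t'), where t is
   the hook in [0,a] x [0,c] and t' the hook in (hook t) x [1,b]. *)
Definition chain_label (q : coords) : nat * nat := let: (i, m, k, p) := q in
  if [|| m == 0, 0 < p | (i == a) && (k == 0)] then (0, 0) else
  let t := minn i (c - k) in (t.+1, minn (i + k - hook_lo t) (b - m)).

(** Hook [t'] of the product starts [t'] steps up hook [t] with [m = 1], whence the successor, and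
    ends at the top of hook [t] with [m = b - t']. *)
Definition chain_lo (l : nat * nat) : nat :=
  if l is (t.+1, t') then (hook_lo t + t').+1 else 0.
Definition chain_hi (l : nat * nat) : nat :=
  if l is (t.+1, t') then hook_hi t + b - t' else (a + b + c).+1.

(** * Ranks and order within a label *)

Lemma hook_bounds i k : i <= a -> k <= c -> ~~ ((i == a) && (k == 0)) ->
  hook_lo (minn i (c - k)) <= i + k <= hook_hi (minn i (c - k)).
Proof. by rewrite /hook_lo /hook_hi; lia. Qed.

(** A full hook has bounds [t] and [a + c - t], and deleting [(a, 0)] moves one of them by one. If
    [t = a = c] nothing is left, which [hook_lo t <= hook_hi t] excludes. *)
Lemma hook_center t : t <= a -> t <= c -> hook_lo t <= hook_hi t ->
  [\/ hook_lo t + hook_hi t = a + c,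
      c < a /\ (hook_lo t + hook_hi t).+1 = a + c
    | a < c /\ hook_lo t + hook_hi t = (a + c).+1].
Proof.
move=> ta tc; rewrite /hook_lo /hook_hi.
have [->|ta'] := eqVneq t a; have [->|tc'] := eqVneq _ c;
  have [ac|ca|ac] := ltngtP a c => /= ne;
  first [by constructor 1; lia | by constructor 2; lia | by constructor 3; lia | lia].
Qed.

Lemma box_coords i m k p : valid_coords (i, m, k, p) ->
  [|| m == 0, 0 < p | (i == a) && (k == 0)] = false ->
  [/\ i <= a, 0 < m <= b, k <= c, p = 0 &
      hook_lo (minn i (c - k)) <= i + k <= hook_hi (minn i (c - k))].
Proof.
case/and5P=> ia mb kc _ _ /norP[m0 /norP[p0 nik]].
by split=> //; [lia | lia | exact: hook_bounds].
Qed.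

Lemma chain_label_bounds q : valid_coords q ->
  chain_lo (chain_label q) <= coord_sum q <= chain_hi (chain_label q).
Proof.
case: q => [[[i m] k] p] V; rewrite /chain_label; case: ifP => [|nb].
  by move: V => /=; lia.
have [ia mb kc -> B] := box_coords _ _ _ _ V nb; clear V nb.
by move: B => /=; move: (hook_lo _) (hook_hi _) => l h; lia.
Qed.

(** Off the long chain [hook_mono] applies twice: in the product it compares [m] and the positions
    along the hook, then in the hook it compares [i] and [k]. *)
Lemma chain_label_mono q q' : valid_coords q -> valid_coords q' ->
  chain_label q = chain_label q' -> coord_sum q <= coord_sum q' -> coord_le q q'.
Proof.
case: q q' => [[[i m] k] p] [[[i' m'] k'] p'] V V'; rewrite /chain_label.
case: ifP => nb; case: ifP => nb' //; first by move: V V' nb nb' => /=; lia.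
have [ia mb kc -> B] := box_coords _ _ _ _ V nb.
have [ia' mb' kc' -> B'] := box_coords _ _ _ _ V' nb'.
clear V V' nb nb'; move=> [et]; rewrite /= -et in B' * => et' le_sum.
have /andP[hu hm] : (i + k - hook_lo (minn i (c - k)) <=
    i' + k' - hook_lo (minn i (c - k))) && (m <= m').
  apply: hook_mono et' _; lia.
have hik : i + k <= i' + k' by clear et et' hm; lia.
by have /andP[-> ->] := hook_mono _ _ _ _ _ kc kc' et hik; rewrite hm.
Qed.

(** The upper points [(a, b, k, 1)] of the long chain are valid for [k > 0] only if [b > 0]. *)
Hypothesis b_gt0 : 0 < b \/ c = 0.

Lemma chain_label_exists q r : valid_coords q ->
  chain_lo (chain_label q) <= r <= chain_hi (chain_label q) ->
  exists q', [/\ valid_coords q', chain_label q' = chain_label q & coord_sum q' = r].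
Proof.
case: q => [[[i m] k] p] V; rewrite /chain_label; case: ifP => nb.
  move=> /= r_le; have [ra|ar] := leqP r a.
    by exists (r, 0, 0, 0); split; rewrite //=; lia.
  have [rb|br] := leqP r (a + b).
    exists (a, r - a, 0, 0); split; rewrite /= ?eqxx ?orbT //; lia.
  by exists (a, b, r - (a + b).+1, 1); split; rewrite /= ?eqxx ?orbT //; lia.
have {V nb} [ia mb kc _ B] := box_coords _ _ _ _ V nb.
set t := minn _ _ in B *; set t' := minn _ _ => /= r_le.
have [t'u t'b] : t' <= i + k - hook_lo t /\ t' <= b - m by rewrite geq_minl geq_minr.
have [ti tc] : t <= i /\ t <= c - k by rewrite geq_minl geq_minr.
clearbody t t'.
(* Here [u] is the distance from the start of hook [t], and [m'] is the new [m] minus one, so that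
   [[1,b]] becomes [[0,b-1]]. *)
have [u [m' [uh m'b et' sum']]] : exists u m', [/\ u <= hook_hi t - hook_lo t,
    m' <= b.-1, minn u (b.-1 - m') = t' & u + m' = r - (hook_lo t).+1].
  by apply: hook_exists; move: r_le B t'u; move: (hook_lo _) (hook_hi _) => l h; lia.
have tlo : t <= hook_lo t := leq_addr _ _.
have hit : hook_hi t <= a + c - t := leq_subr _ _.
have [i' [k' [i'a k'c et sum]]] : exists i' k',
    [/\ i' <= a, k' <= c, minn i' (c - k') = t & i' + k' = hook_lo t + u].
  by clear sum' et' r_le t'u t'b; apply: hook_exists; lia.
(* The corner [(a, 0)] lies only on the last hook, where its sum violates [hook_lo t] or
   [hook_hi t]. *)
have nb' : ~~ ((i' == a) && (k' == 0)).
  clear sum' et' r_le t'u t'b; apply/negP => /andP[/eqP ei /eqP ek].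
  rewrite {}ei {}ek in et sum i'a k'c *.
  have [ac|ca] := leqP a c.
    have ta : t = a by lia.
    by move: sum; rewrite /hook_lo ta ac eqxx; lia.
  have ec : t = c by lia.
  have : hook_hi t < a by rewrite /hook_hi ec ca eqxx; lia.
  lia.
exists (i', m'.+1, k', 0); split.
- by rewrite /= i'a k'c !implybT !andbT; clear -m'b mb; lia.
- by rewrite /= (negPf nb') et sum -et'; congr (_, _); clear -m'b mb; lia.
rewrite /=; clear -sum sum' r_le B t'u uh.
by move: (hook_lo _) sum sum' r_le B t'u uh => l; lia.
Qed.

(** * Ideals of the fence *)

Section FenceIdeals.
Variable alpha : seq nat.
Hypothesis sum_alpha : sumn alpha = a + b + c.
(** The fence rises to [a], falls to [a + b] and rises again; this form also covers one or two
    parts. *)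
Hypothesis coverE : forall x y : fence alpha, fence_cover x y =
  [|| (val y == (val x).+1) && (val y <= a),
      [&& val x == (val y).+1, a <= val y & val x <= a + b]
    | (val y == (val x).+1) && (a + b <= val x)].

Definition coord_set (q : coords) : {set fence alpha} :=
  [set x : fence alpha | coord_mem q (val x)].

Lemma coord_set_ideal q : valid_coords q -> lower_ideal (coord_set q).
Proof.
move=> V; apply/lower_idealP => x y; rewrite !inE => qx.
move=> /connectP[s]; elim: s y => [|z s IHs] y /=; first by move=> _ <-.
case/andP=> yz zs xE; move: (IHs _ zs xE) yz; rewrite coverE.
by case: q V {qx IHs xE} => [[[i m] k] p] /=; lia.
Qed.

(** On each segment, read upwards, membership is closed downwards, so [threshold] yields its
    coordinate; the peak is treated apart. *)
Lemma coord_set_surj (I : fence_ideals alpha) :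
  exists q, valid_coords q && (ideal_set I == coord_set q).
Proof.
pose P (x : nat) : bool := [exists y : fence alpha, (val y == x) && (y \in ideal_set I)].
have PE (y : fence alpha) : P (val y) = (y \in ideal_set I).
  by apply/existsP/idP => [[z /andP[/eqP/val_inj ->]]|yI] //; exists y; rewrite eqxx.
have lt_fence (y : fence alpha) : val y <= a + b + c.
  by rewrite -sum_alpha -ltnS; exact: ltn_ord.
have PS (x y : nat) : y <= a + b + c -> P x ->
    [|| (x == y.+1) && (x <= a), [&& y == x.+1, a <= x & y <= a + b]
      | (x == y.+1) && (a + b <= y)] -> P y.
  move=> yn /existsP[x' /andP[/eqP <- x'I]].
  have yn' : y < (sumn alpha).+1 by rewrite sum_alpha ltnS.
  rewrite -[y]/(val (Ordinal yn' : fence alpha)) -coverE PE => cov.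
  exact: (lower_idealP _ (valP I)) x'I (connect1 cov).
have [i ia Pi] : exists2 i, i <= a & forall x, x < a -> P x = (x < i).
  by apply: threshold => x xa Px; apply: PS Px _; lia.
have [m mb Pm] : exists2 m, m <= b & forall x, x < b -> P (a + b - x) = (x < m).
  by apply: (@threshold (fun x => P (a + b - x))) => x xa Px; apply: PS Px _; lia.
have [k kc Pk] : exists2 k, k <= c & forall x, x < c -> P ((a + b).+1 + x) = (x < k).
  by apply: (@threshold (fun x => P ((a + b).+1 + x))) => x xa Px; apply: PS Px _; lia.
exists (i, m, k, nat_of_bool (P a)); apply/andP; split.
  rewrite /= ia mb kc leq_b1 /=; apply/andP; split; apply/implyP.
    move=> k0; have b0 : 0 < b by lia.
    rewrite -Pm // subn0; apply: (PS ((a + b).+1 + 0)); rewrite ?Pk //; lia.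
  (* The peak forces its neighbours, which are the tops of the two slopes. *)
  rewrite lt0b => Pa; apply/andP; split.
    have [?|a0] := posnP a; first by lia.
    suff : P a.-1 by rewrite Pi; lia.
    by apply: PS Pa _; lia.
  have [?|b0] := posnP b; first by lia.
  suff : P (a + b - b.-1) by rewrite Pm; lia.
  by apply: PS Pa _; lia.
apply/eqP/setP => y; rewrite inE -PE /=.
have := lt_fence y; rewrite /=; move: (nat_of_ord y) => {}y yn.
have [ya|ay|->] := ltngtP y a; last by case: (P a); lia.
  by rewrite Pi //; case: (P a); lia.
have [yb|b_y] := leqP y (a + b).
  have -> : y = a + b - (a + b - y) by lia.
  by rewrite Pm; case: (P a); lia.
have -> : y = (a + b).+1 + (y - (a + b).+1) by lia.
by rewrite Pk; case: (P a); lia.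
Qed.

Definition ideal_coords (I : fence_ideals alpha) : coords := xchoose (coord_set_surj I).

Lemma ideal_coords_valid I : valid_coords (ideal_coords I).
Proof. by have /andP[] := xchooseP (coord_set_surj I). Qed.

Lemma ideal_coordsK I : ideal_set I = coord_set (ideal_coords I).
Proof. by have /andP[_ /eqP] := xchooseP (coord_set_surj I). Qed.

Lemma coords_ideal q (V : valid_coords q) : ideal_coords (Ideal (coord_set_ideal _ V)) = q.
Proof.
apply: (coord_mem_inj _ _ (ideal_coords_valid _) V) => x xn.
have xn' : x < (sumn alpha).+1 by rewrite sum_alpha ltnS.
have /= /setP/(_ (Ordinal xn' : fence alpha)) := ideal_coordsK (Ideal (coord_set_ideal _ V)).
by rewrite !inE.
Qed.

Lemma rank_coords I : fence_rank alpha I = coord_sum (ideal_coords I).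
Proof.
rewrite -(sum_coord_mem _ (ideal_coords_valid I)) -sum_alpha /ideal_rank.
rewrite [in LHS]ideal_coordsK cardE -sum1_size big_enum /= big_mkcond /=.
by apply: eq_bigr => x _; rewrite inE; case: coord_mem.
Qed.

(** If [b = 0] the box is empty and only the long chain, which is symmetric, remains. *)
Lemma fence_chain_decomposition :
  exists D : {set {set fence_ideals alpha}},
    let rk := fence_rank alpha in
    let n := #|fence alpha| in
    [/\ a > c -> bottom_centered_CD rk n D,
        a < c -> top_centered_CD rk n D
      & a = c \/ b = 0 -> symmetric_CD rk n D].
Proof.
have [] := @chain_decomposition_of_labels _ (fence_ideals alpha) _ (fence_rank alpha)
  (fun I => chain_label (ideal_coords I)) chain_lo chain_hi.
- move=> I J; rewrite Order.POrderTheory.lt_leAnge => /andP[IJ nJI].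
  by apply: proper_card; rewrite properE; apply/andP; split; [exact: IJ | exact: nJI].
- by move=> I; rewrite rank_coords; apply/chain_label_bounds/ideal_coords_valid.
- move=> I r /(chain_label_exists _ _ (ideal_coords_valid I))[q [V lq sq]].
  by exists (Ideal (coord_set_ideal _ V)); rewrite ?rank_coords coords_ideal.
- move=> I J; rewrite !rank_coords => lab_eq le_sum; apply/subsetP => x.
  rewrite [ideal_set I]ideal_coordsK [ideal_set J]ideal_coordsK !inE.
  apply: coord_le_mem _ _ _ (ideal_coords_valid J) _.
  exact: chain_label_mono _ _ (ideal_coords_valid _) (ideal_coords_valid _) lab_eq le_sum.
set D := preim_partition _ _ => CD cen; exists D => rk n.
have nE : n = (a + b + c).+1 by rewrite /n card_ord sum_alpha.
have centers C : C \in D -> exists u v, [/\ is_minimum C u, is_maximum C v &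
    [\/ rk u + rk v = n, [/\ 0 < b, c < a & (rk u + rk v).+1 = n]
      | [/\ 0 < b, a < c & rk u + rk v = n.+1]]].
  case/cen=> I [u [v [minu maxv]]]; rewrite -!/(rk _) => ru rv; exists u, v; split=> //.
  have := ideal_coords_valid I; rewrite ru rv nE.
  case: (ideal_coords I) => [[[i m] k] p]; rewrite /chain_label.
  case: ifP => nb V; first by constructor 1.
  have [ia mb kc _ B] := box_coords _ _ _ _ V nb; clear V nb; have b0 : 0 < b by lia.
  have tu := geq_minr (i + k - hook_lo (minn i (c - k))) (b - m).
  (* In the sum of the end ranks [t'] cancels and [[1,b]] contributes [b + 1], so hook [t] alone
     decides the center. *)
  have := hook_center (minn i (c - k)); rewrite /=.
  move: (hook_lo _) (hook_hi _) (minn _ (b - m)) B tu => l h t' B tu [||| S|[ca S]|[ac S]].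
  - lia.
  - lia.
  - lia.
  - by constructor 1; lia.
  - by constructor 2; split=> //; lia.
  - by constructor 3; split=> //; lia.
have center C u v (e : rat) : is_minimum C u -> is_maximum C v ->
    ((rk u + rk v)%:R = e)%R -> has_center rk C (e / 2)%R.
  by move=> minu maxv <-; exists u, v; rewrite GRing.natrD.
split=> ac; split=> // C /centers[u [v [minu maxv [S|[b0 ca S]|[b0 ca S]]]]]; try lia.
- by left; apply: center minu maxv _; rewrite S.
- right; apply: center minu maxv _.
  by rewrite -S -addn1 [in RHS]GRing.natrD GRing.addrK.
- by left; apply: center minu maxv _; rewrite S.
- right; apply: center minu maxv _.
  by rewrite S -addn1 GRing.natrD.
by apply: center minu maxv _; rewrite S.
Qed.

End FenceIdeals.
End Coordinates.

(** * Compositions with one, two and three parts *)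

Theorem theorem1p6 :
  [/\ forall a : nat, is_composition [:: a] ->
        exists D : {set {set fence_ideals [:: a]}},
          symmetric_CD (fence_rank [:: a]) #|fence [:: a]| D,
      forall a b : nat, is_composition [:: a; b] ->
        exists D : {set {set fence_ideals [:: a; b]}},
          bottom_centered_CD (fence_rank [:: a; b]) #|fence [:: a; b]| D
    & forall a b c : nat, is_composition [:: a; b; c] ->
        exists D : {set {set fence_ideals [:: a; b; c]}},
          let rk := fence_rank [:: a; b; c] in
          let n := #|fence [:: a; b; c]| in
          [/\ a > c -> bottom_centered_CD rk n D,
              a < c -> top_centered_CD rk n D
            & a = c -> symmetric_CD rk n D]].
Proof.
split=> [a|a b|a b c].
- move=> _; have [||x y|D [_ _ sD]] := @fence_chain_decomposition a 0 0 _ [:: a].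
  + by right.
  + by rewrite /= !addn0.
  + case: x y => [x /= xn] [y /= yn].
    apply/existsP/idP => [[[[|i] //= _]]|E].
      by rewrite !inE /=; lia.
    by exists ord0; rewrite !inE /=; lia.
  + by exists D; apply: sD; right.
- case/and3P=> a0 b0 _; have [||x y|D [bD _ _]] := @fence_chain_decomposition a b 0 _ [:: a; b].
  + by right.
  + by rewrite /= !addn0.
  + case: x y => [x /= xn] [y /= yn].
    apply/existsP/idP => [[[[|[|i]] //= _]]|E]; try by rewrite !inE /=; lia.
    have [ya|ay] := boolP ((y == x.+1) && (y <= a)).
      by exists ord0; rewrite !inE /=; lia.
    by exists ord_max; rewrite !inE /=; lia.
  (* With [c = 0], the condition [a > c] is the positivity of [a]. *)
  + by exists D; apply: bD.
case/and4P=> a0 b0 c0 _.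
have [||x y|D [bD tD sD]] := @fence_chain_decomposition a b c _ [:: a; b; c].
- by left.
- by rewrite /= !addn0 addnA.
- case: x y => [x /= xn] [y /= yn].
  apply/existsP/idP => [[[[|[|[|i]]] //= _]]|E]; try by rewrite !inE /=; lia.
  (* The witnessing segment is the first for an ascent ending by [a], the second for a descent, and
     the third otherwise. *)
  have [ya|ay] := boolP ((y == x.+1) && (y <= a)).
    by exists ord0; rewrite !inE /=; lia.
  have [yb|b_y] := boolP (x == y.+1).
    by exists (inord 1); rewrite !inE /= inordK //=; lia.
  by exists ord_max; rewrite !inE /=; lia.
by exists D; split=> // ac; apply: sD; left.
Qed.
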